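(* Let $W\subseteq\mathcal{L}_\Sigma$ be finite, let $(D_0,V)\in\mathcal{D}(W)$ and let $T=(D,V)\in\mathcal{D}^*(W)$ be its restriction, $D=\{\delta_1,\ldots,\delta_n\}$, with selector variables $G=\{g_1,\ldots,g_n\}$ as occurring in $\mathit{Ext}[T]$ and $\mathit{Conseq}[T,\cdot]$; let $\varphi\in\mathcal{L}_\Sigma$, and let $\vdash_c,\vdash_s,\vdash_p$ be the credulous, skeptical and prudent unsigned consequence relations with respect to $(D_0,V)$. Then (1) $W\vdash_c\varphi$ iff $\models\exists G(\mathit{Ext}[T]\wedge\mathit{Conseq}[T,\varphi])$; (2) $W\vdash_s\varphi$ iff $\models\neg\exists G(\mathit{Ext}[T]\wedge\neg\mathit{Conseq}[T,\varphi])$; (3) letting $G'=\{g'_1,\ldots,g'_n\}$ be further new variables, $\Psi=\bigwedge_{i=1}^n\big(\neg g'_i\to\exists G(\mathit{Ext}[T]\wedge\neg\mathit{Conseq}[T,c(\delta_i)])\big)$, and $\mathit{Conseq}_{G\leftarrow G'}[T,\varphi]$ the QBF obtained from $\mathit{Conseq}[T,\varphi]$ by replacing each $g_i$ by $g'_i$, we have $W\vdash_p\varphi$ iff $\models\neg\exists G'(\neg\mathit{Conseq}_{G\leftarrow G'}[T,\varphi]\wedge\Psi)$.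
   Context: Propositional logic over $\Sigma$, $\mathcal{L}_\Sigma$, $\mathit{var}$, $\mathit{Cn}$ as usual; finite sets identified with conjunctions; occurrence polarity as usual. $\Sigma^\pm=\{p^+,p^-\mid p\in\Sigma\}$ fresh; $\alpha^\pm$ replaces positive occurrences of $p$ by $p^+$ and negative ones by $\neg p^-$. Default $\delta=\frac{\alpha:\beta}{\gamma}$, $j(\delta)=\beta$, $c(\delta)=\gamma$. Extensions of $(D,V)$: $E_1=V$, $E_{n+1}=\mathit{Cn}(E_n)\cup\{\gamma\mid\frac{\alpha:\beta}{\gamma}\in D,\alpha\in E_n,\neg\beta\notin E\}$; $E$ extension iff $E=\bigcup_nE_n$. $\delta_p=\frac{\top:p^+\equiv\neg p^-}{(p\equiv p^+)\wedge(\neg p\equiv p^-)}$, $D_\Sigma=\{\delta_p\mid p\in\Sigma\}$. Index set $I$: distinct indices for all atom occurrences in $W$; $p$ has complementary occurrences if it occurs positively and negatively in $W$; $W^\pm_I$ replaces, for such $p$, $p^+$/$p^-$ from occurrence $i$ by fresh $p^+_i$/$p^-_i$. $D^1_\Sigma$: for such $p$, $\frac{\top:(p\equiv p^+_i)\wedge(\neg p\equiv p^-_j)}{(p\equiv p^+_i)\wedge(\neg p\equiv p^-_j)}$ ($i$ positive, $j$ negative index), $\delta_p$ otherwise. $D^2_\Sigma$: for such $p$, $\frac{\top:p\equiv p^+_i}{p\equiv p^+_i}$ and $\frac{\top:\neg p\equiv p^-_j}{\neg p\equiv p^-_j}$, $\delta_p$ otherwise. $\mathcal{D}(W)=\{(D_\Sigma,W^\pm)\}\cup\{(D^1_\Sigma,W^\pm_I),(D^2_\Sigma,W^\pm_I)\mid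 I\}$; the restriction of $(D_0,V)$ is $(D,V)$ with $D=\{\delta\in D_0\mid\mathit{var}(\delta)\cap\mathit{var}(W)\ne\emptyset\}$, and $\mathcal{D}^*(W)$ is the set of restrictions. Consequence relations w.r.t. $(D_0,V)\in\mathcal{D}(W)$ with set of extensions $\mathcal{E}$: $\Pi_S=\{c(\delta)\mid\delta\in D_0,\neg j(\delta)\notin S\}$; $W\vdash_c\varphi$ iff $\varphi\in\bigcup_{E\in\mathcal{E}}\mathit{Cn}(V\cup\Pi_E)$; $W\vdash_s\varphi$ iff $\varphi\in\bigcap_{E\in\mathcal{E}}\mathit{Cn}(V\cup\Pi_E)$; $W\vdash_p\varphi$ iff $\varphi\in\mathit{Cn}(V\cup\bigcap_{E\in\mathcal{E}}\Pi_E)$. QBFs with usual semantics ($\models$ = valid). For $T_0$ finite and $S_0$ a finite set of formulas $\psi_k$ each with selector $g_k$: $\mathcal{C}[T_0,S_0]=\exists P(T_0\wedge\bigwedge_{\psi_k\in S_0}(g_k\to\psi_k))$, $P$ the non-selector atoms of $T_0\cup S_0$. $\mathit{Ext}[T]=\mathcal{C}[V,j(D)]\wedge\bigwedge_{i=1}^n(\neg g_i\to\neg\mathcal{C}[V\cup\{j(\delta_i)\},j(D\setminus\{\delta_i\})])$ ($j(\delta_k)$ indexed by $g_k$); $\mathit{Conseq}[T,\chi]=\forall P(V\wedge\bigwedge_{i=1}^n(g_i\to c(\delta_i))\to\chi)$, $P$ the atoms occurring in $T$ or $\chi$.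
   Formalization: Formulas of L_Σ are built from atoms without the constants ⊤ and ⊥ (⊤ in the defaults is the tautology p→p): with constants, W={⊥} has inconsistent W^±, so W ⊢_c φ for all φ while Ext[T] is unsatisfiable, and (1) fails. *)

(* Defs.v *)
From HB Require Import structures.
From mathcomp Require Import all_boot.
From mathcomp Require Import boolp classical_sets.

Set Implicit Arguments.
Unset Strict Implicit.
Unset Printing Implicit Defensive.

Local Open Scope classical_set_scope.

(** * Propositional logic *)

(* There are no primitive truth constants: with a primitive constant false one
   could take W = {false}, whose signed form is inconsistent, whereas the
   signed form of a constant-free W is always consistent. The equivalence is an
   abbreviation, so that every atom occurrence has exactly one polarity. *)
Inductive form (A : Type) : Type :=
| Var of A
| Neg of form A
| And of form A & form A
| Or of form A & form A
| Imp of form A & form A.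

Definition Iff (A : Type) (a b : form A) : form A := And (Imp a b) (Imp b a).

Definition Taut (A : Type) (p : A) : form A := Imp (Var p) (Var p).

Section FormEq.
Variable A : Type.

Fixpoint form_encode (a : form A) : GenTree.tree A :=
  match a with
  | Var p => GenTree.Leaf p
  | Neg b => GenTree.Node 0 [:: form_encode b]
  | And b c => GenTree.Node 1 [:: form_encode b; form_encode c]
  | Or b c => GenTree.Node 2 [:: form_encode b; form_encode c]
  | Imp b c => GenTree.Node 3 [:: form_encode b; form_encode c]
  end.

Fixpoint form_decode (t : GenTree.tree A) : option (form A) :=
  match t with
  | GenTree.Leaf p => Some (Var p)
  | GenTree.Node 0 [:: t1] => omap (@Neg A) (form_decode t1)
  | GenTree.Node 1 [:: t1; t2] =>
      obind (fun b => omap (And b) (form_decode t2)) (form_decode t1)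
  | GenTree.Node 2 [:: t1; t2] =>
      obind (fun b => omap (Or b) (form_decode t2)) (form_decode t1)
  | GenTree.Node 3 [:: t1; t2] =>
      obind (fun b => omap (Imp b) (form_decode t2)) (form_decode t1)
  | _ => None
  end.

Lemma form_encodeK : pcancel form_encode form_decode.
Proof. by elim=> //= [a ->|a -> b ->|a -> b ->|a -> b ->]. Qed.

End FormEq.

HB.instance Definition _ (A : eqType) :=
  Equality.copy (form A) (pcan_type (@form_encodeK A)).

Fixpoint map_form (A B : Type) (f : A -> B) (a : form A) : form B :=
  match a with
  | Var p => Var (f p)
  | Neg b => Neg (map_form f b)
  | And b c => And (map_form f b) (map_form f c)
  | Or b c => Or (map_form f b) (map_form f c)
  | Imp b c => Imp (map_form f b) (map_form f c)
  end.

Fixpoint fvars (A : Type) (a : form A) : seq A :=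
  match a with
  | Var p => [:: p]
  | Neg b => fvars b
  | And b c | Or b c | Imp b c => fvars b ++ fvars c
  end.

Fixpoint feval (A : Type) (v : A -> bool) (a : form A) : bool :=
  match a with
  | Var p => v p
  | Neg b => ~~ feval v b
  | And b c => feval v b && feval v c
  | Or b c => feval v b || feval v c
  | Imp b c => feval v b ==> feval v c
  end.

Definition Cn (A : Type) (S : set (form A)) : set (form A) :=
  [set a | forall v : A -> bool, (forall b, S b -> feval v b) -> feval v a].

(** * Occurrences and polarity *)

(* A position is the path from the root of the formula ([false]: left or only
   subformula, [true]: right subformula); polarity [true] is positive. *)
Definition position := seq bool.

Fixpoint occs_rec (A : Type) (pi : position) (s : bool) (a : form A) :
    seq (position * bool * A) :=
  match a with
  | Var p => [:: (pi, s, p)]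
  | Neg b => occs_rec (rcons pi false) (~~ s) b
  | And b c | Or b c =>
      occs_rec (rcons pi false) s b ++ occs_rec (rcons pi true) s c
  | Imp b c =>
      occs_rec (rcons pi false) (~~ s) b ++ occs_rec (rcons pi true) s c
  end.

Definition occs (A : Type) (a : form A) := occs_rec [::] true a.

Fixpoint replace_rec (A B : Type) (f : position -> bool -> A -> form B)
    (pi : position) (s : bool) (a : form A) : form B :=
  match a with
  | Var p => f pi s p
  | Neg b => Neg (replace_rec f (rcons pi false) (~~ s) b)
  | And b c => And (replace_rec f (rcons pi false) s b)
                   (replace_rec f (rcons pi true) s c)
  | Or b c => Or (replace_rec f (rcons pi false) s b)
                 (replace_rec f (rcons pi true) s c)
  | Imp b c => Imp (replace_rec f (rcons pi false) (~~ s) b)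
                   (replace_rec f (rcons pi true) s c)
  end.

Definition replace_occs (A B : Type) (f : position -> bool -> A -> form B)
    (a : form A) : form B := replace_rec f [::] true a.

(** * Signed alphabet *)

Inductive satom (Sigma : Type) : Type :=
| Orig of Sigma            (* p     *)
| Plus of Sigma            (* p^+   *)
| Minus of Sigma           (* p^-   *)
| PlusI of Sigma & nat     (* p^+_i *)
| MinusI of Sigma & nat.   (* p^-_i *)

Arguments Orig {Sigma}.

Section SatomEq.
Variable Sigma : Type.

Definition satom_encode (x : satom Sigma) : Sigma * option (bool * option nat) :=
  match x with
  | Orig p => (p, None)
  | Plus p => (p, Some (true, None))
  | Minus p => (p, Some (false, None))
  | PlusI p i => (p, Some (true, Some i))
  | MinusI p i => (p, Some (false, Some i))
  end.

Definition satom_decode (x : Sigma * option (bool * option nat)) : satom Sigma :=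
  match x with
  | (p, None) => Orig p
  | (p, Some (true, None)) => Plus p
  | (p, Some (false, None)) => Minus p
  | (p, Some (true, Some i)) => PlusI p i
  | (p, Some (false, Some i)) => MinusI p i
  end.

Lemma satom_encodeK : cancel satom_encode satom_decode.
Proof. by case. Qed.

End SatomEq.

HB.instance Definition _ (Sigma : eqType) :=
  Equality.copy (satom Sigma) (can_type (@satom_encodeK Sigma)).

Definition embed (Sigma : Type) (a : form Sigma) : form (satom Sigma) :=
  map_form Orig a.

(** * Default logic *)

Record default (A : Type) : Type :=
  Default { pre : form A; just : form A; concl : form A }.

(* The set of facts is finite and represented by a list, whose order and
   repetitions are irrelevant; the set of defaults may be infinite. *)
Record theory (A : Type) : Type :=
  Theory { defaults : set (default A); facts : seq (form A) }.

Definition dvars (A : Type) (d : default A) : seq A :=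
  fvars (pre d) ++ fvars (just d) ++ fvars (concl d).

Definition fact_set (A : eqType) (T : theory A) : set (form A) :=
  [set a | a \in facts T].

(* [stage T E n] is the set E_{n+1}, with E_1 = V. *)
Fixpoint stage (A : eqType) (T : theory A) (E : set (form A)) (n : nat) :
    set (form A) :=
  match n with
  | 0 => fact_set T
  | m.+1 => Cn (stage T E m) `|`
      [set concl d | d in
         [set d | [/\ defaults T d, stage T E m (pre d) & ~ E (Neg (just d))]]]
  end.

Definition extensions (A : eqType) (T : theory A) : set (set (form A)) :=
  [set E | E = \bigcup_n stage T E n].

(** * Signed default theories *)

Section Signed.
Variable Sigma : eqType.
Implicit Types (p : Sigma) (W : seq (form Sigma)).
Implicit Types (I : form Sigma * position -> nat).

Definition occurs (s : bool) p W : bool :=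
  has (fun a => has (fun o => (o.1.2 == s) && (o.2 == p)) (occs a)) W.

Definition complementary W p : bool := occurs true p W && occurs false p W.

(* An occurrence of an atom in W is a member of W together with a position in
   that formula. *)
Definition occurrences W : seq (form Sigma * position) :=
  [seq (a, o.1.1) | a <- W, o <- occs a].

Definition indexing W I : Prop := {in occurrences W &, injective I}.

Definition index_of W I (s : bool) p : set nat :=
  [set i | exists a pi, [/\ a \in W, (pi, s, p) \in occs a & I (a, pi) = i]].

Definition signed_lit (s : bool) p : form (satom Sigma) :=
  if s then Var (Plus p) else Neg (Var (Minus p)).

Definition signed_form (a : form Sigma) : form (satom Sigma) :=
  replace_occs (fun _ s p => signed_lit s p) a.

Definition signed_set W : seq (form (satom Sigma)) :=
  [seq signed_form a | a <- W].

Definition signed_formI W I (a : form Sigma) : form (satom Sigma) :=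
  replace_occs (fun pi s p =>
    if complementary W p then
      if s then Var (PlusI p (I (a, pi))) else Neg (Var (MinusI p (I (a, pi))))
    else signed_lit s p) a.

Definition signed_setI W I : seq (form (satom Sigma)) :=
  [seq signed_formI W I a | a <- W].

Definition delta_ p : default (satom Sigma) :=
  Default (Taut (Orig p))
    (Iff (Var (Plus p)) (Neg (Var (Minus p))))
    (And (Iff (Var (Orig p)) (Var (Plus p)))
         (Iff (Neg (Var (Orig p))) (Var (Minus p)))).

Definition D_Sigma : set (default (satom Sigma)) := [set delta_ p | p in setT].

Definition normal_default p (b : form (satom Sigma)) : default (satom Sigma) :=
  Default (Taut (Orig p)) b b.

Definition plus_eq p (i : nat) : form (satom Sigma) :=
  Iff (Var (Orig p)) (Var (PlusI p i)).

Definition minus_eq p (j : nat) : form (satom Sigma) :=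
  Iff (Neg (Var (Orig p))) (Var (MinusI p j)).

Definition D1_Sigma W I : set (default (satom Sigma)) :=
  [set d | exists p, if complementary W p then
             exists i j, [/\ index_of W I true p i, index_of W I false p j
               & d = normal_default p (And (plus_eq p i) (minus_eq p j))]
           else d = delta_ p].

Definition D2_Sigma W I : set (default (satom Sigma)) :=
  [set d | exists p, if complementary W p then
             (exists2 i, index_of W I true p i
                & d = normal_default p (plus_eq p i)) \/
             (exists2 j, index_of W I false p j
                & d = normal_default p (minus_eq p j))
           else d = delta_ p].

Inductive signed_theories W : set (theory (satom Sigma)) :=
| SignedTheory :
    signed_theories W (Theory D_Sigma (signed_set W))
| SignedTheory1 I : indexing W I ->
    signed_theories W (Theory (D1_Sigma W I) (signed_setI W I))
| SignedTheory2 I : indexing W I ->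
    signed_theories W (Theory (D2_Sigma W I) (signed_setI W I)).

Definition restriction W (T0 : theory (satom Sigma)) : theory (satom Sigma) :=
  Theory
    [set d | defaults T0 d /\
       exists p a, [/\ a \in W, p \in fvars a & Orig p \in dvars d]]
    (facts T0).

(** ** Unsigned consequence relations *)

Definition Pi (T0 : theory (satom Sigma)) (S : set (form (satom Sigma))) :
    set (form (satom Sigma)) :=
  [set concl d | d in [set d | defaults T0 d /\ ~ S (Neg (just d))]].

Definition credulous (T0 : theory (satom Sigma)) (phi : form Sigma) : Prop :=
  (\bigcup_(E in extensions T0) Cn (fact_set T0 `|` Pi T0 E)) (embed phi).

Definition skeptical (T0 : theory (satom Sigma)) (phi : form Sigma) : Prop :=
  (\bigcap_(E in extensions T0) Cn (fact_set T0 `|` Pi T0 E)) (embed phi).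

Definition prudent (T0 : theory (satom Sigma)) (phi : form Sigma) : Prop :=
  Cn (fact_set T0 `|` \bigcap_(E in extensions T0) Pi T0 E) (embed phi).

End Signed.

(** * Quantified Boolean formulas *)

Inductive qbf (X : Type) : Type :=
| QTrue
| QVar of X
| QNeg of qbf X
| QAnd of qbf X & qbf X
| QOr of qbf X & qbf X
| QImp of qbf X & qbf X
| QEx of X & qbf X
| QAll of X & qbf X.

Arguments QTrue {X}.

Fixpoint qeval (X : eqType) (v : X -> bool) (q : qbf X) : bool :=
  match q with
  | QTrue => true
  | QVar x => v x
  | QNeg r => ~~ qeval v r
  | QAnd r t => qeval v r && qeval v t
  | QOr r t => qeval v r || qeval v t
  | QImp r t => qeval v r ==> qeval v t
  | QEx x r => qeval [eta v with x |-> true] r || qeval [eta v with x |-> false] r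
  | QAll x r => qeval [eta v with x |-> true] r && qeval [eta v with x |-> false] r
  end.

Definition valid (X : eqType) (q : qbf X) : Prop := forall v, qeval v q.

Definition QExs (X : Type) (xs : seq X) (q : qbf X) : qbf X := foldr (@QEx X) q xs.
Definition QAlls (X : Type) (xs : seq X) (q : qbf X) : qbf X := foldr (@QAll X) q xs.
Definition QConj (X : Type) (qs : seq (qbf X)) : qbf X := foldr (@QAnd X) QTrue qs.

(* Every occurrence of a variable is replaced, including in quantifiers. *)
Fixpoint qrename (X Y : Type) (f : X -> Y) (q : qbf X) : qbf Y :=
  match q with
  | QTrue => QTrue
  | QVar x => QVar (f x)
  | QNeg r => QNeg (qrename f r)
  | QAnd r t => QAnd (qrename f r) (qrename f t)
  | QOr r t => QOr (qrename f r) (qrename f t)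
  | QImp r t => QImp (qrename f r) (qrename f t)
  | QEx x r => QEx (f x) (qrename f r)
  | QAll x r => QAll (f x) (qrename f r)
  end.

(** * Encodings *)

Inductive qatom (A : Type) : Type :=
| Atom of A
| Sel of nat      (* g_i  *)
| Sel' of nat.    (* g'_i *)

Arguments Sel {A}.
Arguments Sel' {A}.

Section QatomEq.
Variable A : Type.

Definition qatom_encode (x : qatom A) : A + (nat + nat) :=
  match x with
  | Atom a => inl a
  | Sel i => inr (inl i)
  | Sel' i => inr (inr i)
  end.

Definition qatom_decode (x : A + (nat + nat)) : qatom A :=
  match x with
  | inl a => Atom a
  | inr (inl i) => Sel i
  | inr (inr i) => Sel' i
  end.

Lemma qatom_encodeK : cancel qatom_encode qatom_decode.
Proof. by case. Qed.

End QatomEq.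

HB.instance Definition _ (A : eqType) :=
  Equality.copy (qatom A) (can_type (@qatom_encodeK A)).

Section Encoding.
Variable A : eqType.

Fixpoint qform (a : form A) : qbf (qatom A) :=
  match a with
  | Var p => QVar (Atom p)
  | Neg b => QNeg (qform b)
  | And b c => QAnd (qform b) (qform c)
  | Or b c => QOr (qform b) (qform c)
  | Imp b c => QImp (qform b) (qform c)
  end.

Definition seq_vars (V : seq (form A)) : seq A := flatten [seq fvars a | a <- V].

(* S pairs each formula with the index of its selector. *)
Definition Compat (T : seq (form A)) (S : seq (nat * form A)) : qbf (qatom A) :=
  QExs [seq Atom x | x <- undup (seq_vars T ++ seq_vars (unzip2 S))]
    (QAnd (QConj [seq qform a | a <- T])
          (QConj [seq QImp (QVar (Sel s.1)) (qform s.2) | s <- S])).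

Section FixTheory.
Variables (n : nat) (delta : 'I_n -> default A) (V : seq (form A)).

Definition Ext : qbf (qatom A) :=
  QAnd (Compat V [seq (nat_of_ord k, just (delta k)) | k <- enum 'I_n])
    (QConj [seq QImp (QNeg (QVar (Sel i)))
                  (QNeg (Compat (just (delta i) :: V)
                     [seq (nat_of_ord k, just (delta k))
                     | k <- enum 'I_n & k != i]))
           | i : 'I_n <- enum 'I_n]).

Definition Conseq (chi : form A) : qbf (qatom A) :=
  QAlls [seq Atom x | x <- undup (seq_vars V
             ++ flatten [seq dvars (delta i) | i <- enum 'I_n] ++ fvars chi)]
    (QImp (QAnd (QConj [seq qform a | a <- V])
                (QConj [seq QImp (QVar (Sel i)) (qform (concl (delta i)))
                       | i : 'I_n <- enum 'I_n]))
          (qform chi)).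

Definition prime_sel (x : qatom A) : qatom A :=
  if x is Sel i then Sel' i else x.

Definition Conseq' (chi : form A) : qbf (qatom A) :=
  qrename prime_sel (Conseq chi).

Definition G : seq (qatom A) := [seq Sel i | i <- iota 0 n].
Definition G' : seq (qatom A) := [seq Sel' i | i <- iota 0 n].

Definition Psi : qbf (qatom A) :=
  QConj [seq QImp (QNeg (QVar (Sel' i)))
               (QExs G (QAnd Ext (QNeg (Conseq (concl (delta i))))))
        | i : 'I_n <- enum 'I_n].

End FixTheory.

End Encoding.

Arguments G {A} n.
Arguments G' {A} n.

(* Main.v *)
Require Import Defs.
From mathcomp Require Import all_boot.
From mathcomp Require Import boolp classical_sets.

(** Since the prerequisites are tautologies, [E] is an extension of [(D0, V)]
    iff [E = Cn (V u Pi_E)]. Every conclusion entails its justification, and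
    conversely a model of [V] and of some justifications becomes a model of [V]
    and of the corresponding conclusions by setting [p := p^+] for every [p]
    governed by [delta_p], as [p] occurs neither in [V] nor in another
    justification. Hence the sets of generating defaults of the extensions are
    the subsets of [D0] whose justifications are maximally consistent with [V].
    The defaults removed by the restriction concern atoms outside [W]; they
    belong to every such set, and they are satisfied by choosing [p^+], [p^-]
    according to [p], which affects nothing else. So one may work with the
    finite [D], where [Ext] says of the selectors that they form a maximal set.
    Such sets exist because the signed facts are consistent (make all signed
    atoms true). For prudent consequence, a conclusion of [D] that is entailed
    by [E] is in [Pi_E] (its justification is then not refuted), so [Psi] says
    that [G'] contains the selectors of all conclusions common to the [Pi_E]. *)

Set Implicit Arguments.
Unset Strict Implicit.
Unset Printing Implicit Defensive.

(** * Default theories governed by their justifications *)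

Section Consequence.
Local Open Scope classical_set_scope.

Variable A : eqType.
Implicit Types (a : form A) (v w : A -> bool) (X Y : set (form A)).

Lemma eq_in_feval v w a : {in fvars a, v =1 w} -> feval v a = feval w a.
Proof.
elim: a => /= [p|b IHb|b IHb c IHc|b IHb c IHc|b IHb c IHc] vw.
- by apply: vw; rewrite mem_head.
- by rewrite IHb.
all: by rewrite IHb ?IHc // => x xa; apply: vw; rewrite mem_cat xa ?orbT.
Qed.

Definition holds v : set (form A) := [set a | feval v a].

Definition satisfiable X : Prop := exists v, X `<=` holds v.

Lemma satisfiableS X Y : X `<=` Y -> satisfiable Y -> satisfiable X.
Proof. by move=> XY [v Yv]; exists v; apply: subset_trans Yv. Qed.

Lemma subset_Cn X Y : X `<=` Y -> Cn X `<=` Cn Y.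
Proof. by move=> XY a Xa v Yv; apply: Xa => b /XY; apply: Yv. Qed.

Lemma CnNeg X a : Cn X (Neg a) <-> ~ satisfiable (a |` X).
Proof.
split=> [Xa [v]|unsat v Xv].
  by rewrite subUset sub1set inE => -[/= va /Xa /=]; rewrite va.
by apply/negP => va; apply: unsat; exists v; rewrite subUset sub1set inE.
Qed.

Lemma Cn_conservative (h : (A -> bool) -> A -> bool) X Y a :
    X `<=` Y -> (forall v, X `<=` holds v -> Y `<=` holds (h v)) ->
    (forall v, feval (h v) a = feval v a) ->
  Cn Y a <-> Cn X a.
Proof.
move=> XY hXY ha; split=> [Ya v Xv|]; last exact: subset_Cn.
by rewrite -ha; apply: Ya; apply: hXY.
Qed.

End Consequence.

Section DefaultTheories.
Local Open Scope classical_set_scope.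

Variable A : eqType.
Implicit Types (T : theory A) (d : default A) (v : A -> bool).
Implicit Types (V E : set (form A)) (D S : set (default A)).

Definition generating_defaults T E : set (default A) :=
  [set d | defaults T d /\ ~ E (Neg (just d))].

Definition generated V S : set (form A) := Cn (V `|` [set concl d | d in S]).

Lemma subset_generated V S S' : S `<=` S' -> generated V S `<=` generated V S'.
Proof. by move=> SS'; apply/subset_Cn/setUS/image_subset. Qed.

Lemma extension_prerequisite_free T E :
    (forall d v, defaults T d -> feval v (pre d)) ->
  extensions T E <-> E = generated (fact_set T) (generating_defaults T E).
Proof.
move=> pre_valid.
suff stages :
    \bigcup_k stage T E k = generated (fact_set T) (generating_defaults T E).
  by rewrite /extensions /= stages.
apply/seteqP; split=> [a [k _]|a Ea].
  elim: k a => [a aV v|k IHk a]; first by apply; left.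
  case=> [ka v vE|[d [dD _ dE] <-] v]; last by apply; right; exists d.
  by apply: ka => b /IHk; apply.
(* Prerequisites are derived in stage 1, conclusions in stage 2. *)
exists 3%N => //; left => v v2; apply: Ea => b [bV|[d [dD dE] <-]].
  by apply: v2; left => w; apply; left => u; apply.
by apply: v2; right; exists d => //; split=> //; left => u _; apply: pre_valid.
Qed.

Definition justified V S : Prop := satisfiable (V `|` [set just d | d in S]).

Definition maximal_justified V D : set (set (default A)) :=
  [set S | [/\ S `<=` D, justified V S
             & forall d, D d -> justified V (d |` S) -> S d]].

Lemma holds_setU_image (f : default A -> form A) V S v :
  V `|` [set f d | d in S] `<=` holds v <->
  V `<=` holds v /\ forall d, S d -> feval v (f d).
Proof. by rewrite subUset image_subP. Qed.

Lemma subset_justified V S S' : S `<=` S' -> justified V S' -> justified V S.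
Proof. by move=> SS'; apply/satisfiableS/setUS/image_subset. Qed.

Lemma justified_setU1 V S d :
  justified V (d |` S) <->
  satisfiable (just d |` (V `|` [set just e | e in S])).
Proof. by rewrite /justified image_setU image_set1 setUCA. Qed.

(* [governed_concl] is weaker than asking that each conclusion follow from its
   justification: the model may change, but serves all defaults at once. *)
Record justification_governed V D : Prop := {
  governed_pre : forall d v, D d -> feval v (pre d);
  governed_just : forall d v, D d -> feval v (concl d) -> feval v (just d);
  governed_concl : forall v, V `<=` holds v -> exists2 w, V `<=` holds w
    & forall d, D d -> feval v (just d) -> feval w (concl d);
  governed_facts : satisfiable V }.

Lemma subset_governed V D D' :
  D `<=` D' -> justification_governed V D' -> justification_governed V D.
Proof.
move=> DD' [preV concl_just just_concl satV]; split=> // [d v /DD'|d v /DD'|v].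
- exact: preV.
- exact: concl_just.
- by case/just_concl=> w wV wc; exists w => // d /DD'; apply: wc.
Qed.

Section Governed.
Variables (V : set (form A)) (D : set (default A)).
Hypothesis governed : justification_governed V D.

Lemma justified_concl S : S `<=` D ->
  justified V S <-> satisfiable (V `|` [set concl d | d in S]).
Proof.
move=> SD; split=> -[v /holds_setU_image[Vv Sv]].
  have [w Vw wc] := governed_concl governed Vv.
  by exists w; apply/holds_setU_image; split=> // d Sd; apply/wc/Sv/Sd/SD.
exists v; apply/holds_setU_image; split=> // d Sd.
exact/(governed_just governed)/Sv/Sd/SD.
Qed.

Lemma generated_NegP S d : S `<=` D -> D d ->
  ~ generated V S (Neg (just d)) <-> justified V (d |` S).
Proof.
move=> SD Dd; rewrite /generated CnNeg notK; split.
  case=> v; rewrite subUset sub1set inE holds_setU_image => -[vd [Vv Sv]].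
  apply/justified_setU1; exists v; rewrite subUset sub1set inE; split=> //.
  apply/holds_setU_image; split=> // e Se.
  exact/(governed_just governed)/Sv/Se/SD.
have dSD : d |` S `<=` D by rewrite subUset sub1set inE.
move/(justified_concl dSD) => [v /holds_setU_image[Vv dSv]].
exists v; rewrite subUset sub1set inE; split.
  by apply: (governed_just governed Dd); apply: dSv; left.
by apply/holds_setU_image; split=> // e Se; apply: dSv; right.
Qed.

Lemma maximal_justifiedP S :
  maximal_justified V D S <-> S = [set d | D d /\ justified V (d |` S)].
Proof.
split=> [[SD SJ Smax]|SE].
  apply/seteqP; split=> d => [Sd|[Dd]]; last exact: Smax.
  by split; [exact: SD | rewrite setUidr // sub1set inE].
have SD : S `<=` D by move=> d; rewrite SE => -[].
split=> // [|d Dd dS]; last by rewrite SE.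
have [->|/set0P[d Sd]] := eqVneq S set0.
  by rewrite /justified image_set0 setU0; apply: governed_facts governed.
move: (Sd); rewrite {1}SE => -[_]; apply: subset_justified; exact: subsetUr.
Qed.

Lemma generated_concl S d :
  maximal_justified V D S -> D d -> generated V S (concl d) -> S d.
Proof.
move=> [SD SJ Smax] Dd Sd; apply: Smax => //.
apply/justified_concl; first by rewrite subUset sub1set inE.
have /(justified_concl SD)[v vS] := SJ; exists v.
rewrite image_setU image_set1 setUCA subUset sub1set inE; split=> //.
exact: Sd.
Qed.

Definition skeptical_defaults : set (default A) :=
  [set d | D d /\ forall S, maximal_justified V D S -> generated V S (concl d)].

Lemma bigcap_maximal_concl : maximal_justified V D !=set0 ->
  \bigcap_(S in maximal_justified V D) [set concl d | d in S] =
  [set concl d | d in skeptical_defaults].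
Proof.
move=> [S0 S0max]; apply/seteqP; split=> [c all_c|_ [d [Dd dS] <-] S Smax].
  have [d S0d dc] := all_c _ S0max; have [S0D _ _] := S0max.
  exists d => //; split=> [|S Smax]; first exact: S0D.
  by rewrite dc => v; apply; right; apply: all_c.
by exists d => //; apply: generated_concl => //; apply: dS.
Qed.

End Governed.

Lemma image_generating_extensions T :
    justification_governed (fact_set T) (defaults T) ->
  generating_defaults T @` extensions T =
  maximal_justified (fact_set T) (defaults T).
Proof.
move=> gov; have extE E := extension_prerequisite_free E (governed_pre gov).
have genE S : S `<=` defaults T ->
    generating_defaults T (generated (fact_set T) S) =
    [set d | defaults T d /\ justified (fact_set T) (d |` S)].
  by move=> SD; apply/seteqP; split=> d [Dd] /(generated_NegP gov SD Dd).
apply/seteqP; split=> [_ [E /extE E_generated <-]|S Smax].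
  by apply/(maximal_justifiedP gov); rewrite -genE -?E_generated // => d [].
have [SD _ _] := Smax.
have gS : generating_defaults T (generated (fact_set T) S) = S.
  by rewrite genE //; apply/esym/(maximal_justifiedP gov).
by exists (generated (fact_set T) S) => //; apply/extE; rewrite gS.
Qed.

End DefaultTheories.

Section Completion.
Local Open Scope classical_set_scope.

Variables (A : eqType) (V : set (form A)) (D D0 : set (default A)).
Implicit Types (S : set (default A)) (v : A -> bool).

Record completion (h : (A -> bool) -> A -> bool) : Prop := {
  completion_facts : forall v, V `<=` holds v -> V `<=` holds (h v);
  completion_just : forall v d, D d -> feval (h v) (just d) = feval v (just d);
  completion_concl :
    forall v d, D d -> feval (h v) (concl d) = feval v (concl d);
  completion_outside : forall v d, (D0 `\` D) d -> feval (h v) (concl d) }.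

Variable h : (A -> bool) -> A -> bool.
Hypotheses (DD0 : D `<=` D0) (governed : justification_governed V D0).
Hypothesis compl : completion h.

Lemma justified_setU_outside S : S `<=` D0 ->
  justified V (S `&` D) -> justified V (S `|` (D0 `\` D)).
Proof.
move=> SD0 [v /holds_setU_image[Vv SDv]]; exists (h v).
have outside d : (D0 `\` D) d -> feval (h v) (just d).
  move=> D0d; apply: (governed_just governed); first by case: D0d.
  exact: (completion_outside compl).
apply/holds_setU_image; split=> [|d [Sd|/outside //]].
  exact: completion_facts Vv.
have [Dd|ND] := pselect (D d); last by apply: outside; split=> //; apply: SD0.
by rewrite (completion_just compl) ?SDv.
Qed.

Lemma outside_maximal_justified S :
  maximal_justified V D0 S -> D0 `\` D `<=` S.
Proof.
move=> [SD0 SJ Smax] d D0d; apply: Smax; first by case: D0d.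
apply: (subset_justified (S' := S `|` (D0 `\` D))).
  by move=> e [->|]; [right|left].
apply: justified_setU_outside => //.
by apply: subset_justified SJ; apply: subIsetl.
Qed.

Lemma maximal_justified_restrict S :
  maximal_justified V D0 S -> maximal_justified V D (S `&` D).
Proof.
move=> [SD0 SJ Smax]; split=> [||d Dd dJ]; first exact: subIsetr.
  by apply: subset_justified SJ; apply: subIsetl.
split=> //; apply: Smax; first exact: DD0.
apply: (subset_justified (S' := (d |` S) `|` (D0 `\` D))); first by left.
apply: justified_setU_outside.
  by rewrite subUset sub1set inE; split=> //; apply: DD0.
by apply: subset_justified dJ => e [[->|Se] De]; [left|right].
Qed.

Lemma maximal_justified_extend S :
  maximal_justified V D S -> maximal_justified V D0 (S `|` (D0 `\` D)).
Proof.
move=> [SD SJ Smax]; have SD0 := subset_trans SD DD0; split=> [||d D0d dJ].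
- by rewrite subUset; split=> //; apply: subDsetl.
- by apply: justified_setU_outside => //; rewrite setIidl.
- have [Dd|ND] := pselect (D d); last by right.
  by left; apply: Smax => //; apply: subset_justified dJ; apply: setUS; left.
Qed.

Lemma maximal_justified_completion :
  maximal_justified V D0 = [set S `|` (D0 `\` D) | S in maximal_justified V D].
Proof.
apply/seteqP; split=> [S Smax|_ [S Smax <-]].
  exists (S `&` D); first exact: maximal_justified_restrict.
  rewrite setUIl (setUidl (outside_maximal_justified Smax)) setDE setUIr setUv.
  by rewrite setIT setIidl //; have [SD0 _ _] := Smax; right; apply: SD0.
exact: maximal_justified_extend.
Qed.

Variable a : form A.
Hypothesis compl_a : forall v, feval (h v) a = feval v a.

Lemma generated_completion S :
  S `<=` D -> generated V (S `|` (D0 `\` D)) a <-> generated V S a.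
Proof.
move=> SD; apply: (Cn_conservative (h := h)) => // [|v].
  by apply/setUS/image_subset; left.
move=> /holds_setU_image[Vv Sv]; apply/holds_setU_image.
split=> [|d [Sd|D0d]]; first exact: completion_facts Vv.
  by rewrite (completion_concl compl) ?Sv //; apply: SD.
exact: completion_outside.
Qed.

Lemma bigcup_generated_completion :
  (\bigcup_(S in maximal_justified V D0) generated V S) a <->
  (\bigcup_(S in maximal_justified V D) generated V S) a.
Proof.
rewrite maximal_justified_completion bigcup_image.
by split=> -[S Smax Sa]; exists S => //; move: Sa;
  rewrite generated_completion //; case: Smax.
Qed.

Lemma bigcap_generated_completion :
  (\bigcap_(S in maximal_justified V D0) generated V S) a <->
  (\bigcap_(S in maximal_justified V D) generated V S) a.
Proof.
rewrite maximal_justified_completion bigcap_image.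
by split=> all_a S Smax; have := all_a S Smax;
  rewrite generated_completion //; case: Smax.
Qed.

Lemma Cn_bigcap_completion : maximal_justified V D !=set0 ->
  Cn (V `|` \bigcap_(S in maximal_justified V D0) [set concl d | d in S]) a <->
  Cn (V `|` \bigcap_(S in maximal_justified V D) [set concl d | d in S]) a.
Proof.
move=> [S Smax]; rewrite maximal_justified_completion bigcap_image.
apply: (Cn_conservative (h := h)) => // [|v].
  by apply: setUS => c all_c S' /all_c; apply: image_subset; left.
rewrite !subUset => -[Vv conclv]; split; first exact: completion_facts Vv.
move=> c all_c.
have [[d D0d <-]|cN] := pselect ([set concl d | d in D0 `\` D] c).
  exact: completion_outside.
have {}all_c S' : maximal_justified V D S' -> [set concl d | d in S'] c.
  by move=> /all_c; rewrite image_setU => -[].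
have [[d Sd dc] [SD _ _]] := (all_c S Smax, Smax).
rewrite -dc /holds /= (completion_concl compl); last exact: SD.
by rewrite dc; apply: conclv.
Qed.

End Completion.

(** * Semantics of the encodings *)

Fixpoint qvars (X : Type) (q : qbf X) : seq X :=
  match q with
  | QTrue => [::]
  | QVar x => [:: x]
  | QNeg r => qvars r
  | QAnd r t | QOr r t | QImp r t => qvars r ++ qvars t
  | QEx x r | QAll x r => x :: qvars r
  end.

Section QbfRenaming.
Variables X Y : eqType.
Implicit Types (v : X -> bool) (q : qbf X) (P : pred X).

Lemma all_qvars_QAlls P xs q :
  all P (qvars (QAlls xs q)) = all P xs && all P (qvars q).
Proof. by elim: xs => //= x xs ->; rewrite andbA. Qed.

Lemma all_qvars_QConj P qs :
  all P (qvars (QConj qs)) = all (fun q => all P (qvars q)) qs.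
Proof. by elim: qs => //= q qs <-; rewrite all_cat. Qed.

Lemma qeval_qrename P (f : X -> Y) (u : Y -> bool) v q :
    {in P &, injective f} -> {in P, u \o f =1 v} -> all P (qvars q) ->
  qeval u (qrename f q) = qeval v q.
Proof.
move=> f_inj.
have eq_update x b u' v' : P x -> {in P, u' \o f =1 v'} ->
    {in P, [eta u' with f x |-> b] \o f =1 [eta v' with x |-> b]}.
  by move=> Px uv y Py /=; rewrite (inj_in_eq f_inj) // -uv.
elim: q u v => //=
  [x|r IHr|r IHr t IHt|r IHr t IHt|r IHr t IHt|x r IHr|x r IHr] u v uv.
- by rewrite andbT; apply: uv.
- by move=> /(IHr _ _ uv)->.
1-3: by rewrite all_cat => /andP[/(IHr _ _ uv)-> /(IHt _ _ uv)->].
all: move=> /andP[Px Pr]; have uvb b := eq_update x b u v Px uv.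
all: by rewrite (IHr _ _ (uvb true) Pr) (IHr _ _ (uvb false) Pr).
Qed.

End QbfRenaming.

Section QbfQuantifiers.
Variable X : eqType.
Implicit Types (v w : X -> bool) (q : qbf X) (P : pred X) (xs : seq X).

Lemma qrename_id q : qrename id q = q.
Proof.
by elim: q => //= [q ->|q -> r ->|q -> r ->|q -> r ->|x q ->|x q ->].
Qed.

Lemma eq_in_qeval P v w q :
  {in P, v =1 w} -> all P (qvars q) -> qeval v q = qeval w q.
Proof.
by move=> vw Pq; rewrite -[q in LHS]qrename_id; apply: qeval_qrename vw Pq.
Qed.

Lemma qeval_QExsP v xs q :
  reflect (exists2 w, {in predC (mem xs), w =1 v} & qeval w q)
          (qeval v (QExs xs q)).
Proof.
elim: xs v => [|x xs IHxs] v /=.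
  apply: (iffP idP) => [vq|[w wv]]; first by exists v.
  by have -> : w = v by apply: funext => y; apply: wv.
apply: (iffP orP).
  move=> vq; have [b /IHxs[w wv wq]] :
      exists b, qeval [eta v with x |-> b] (QExs xs q).
    by case: vq => ?; [exists true | exists false].
  exists w => // y; rewrite !inE negb_or => /andP[yx yxs].
  by rewrite wv ?inE //= (negbTE yx).
case=> w wv wq; have : qeval [eta v with x |-> w x] (QExs xs q).
  apply/IHxs; exists w => // y; rewrite inE => yxs /=.
  by case: eqVneq => [->//|yx]; rewrite wv // !inE negb_or yx.
by case: (w x) => ?; [left | right].
Qed.

Lemma qeval_QAlls v xs q :
  qeval v (QAlls xs q) = ~~ qeval v (QExs xs (QNeg q)).
Proof.
elim: xs v => [|x xs IHxs] v /=; first by rewrite negbK.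
by rewrite !IHxs negb_or.
Qed.

Lemma qeval_QConj v qs : qeval v (QConj qs) = all (qeval v) qs.
Proof. by elim: qs => //= q qs ->. Qed.

Lemma qeval_QConj_enum (I : finType) (f : I -> qbf X) v :
  qeval v (QConj [seq f i | i <- enum I]) <-> forall i, qeval v (f i).
Proof.
by rewrite qeval_QConj all_map; split=> [/allP vf i|vf];
  [apply: vf; rewrite mem_enum | apply/allP => i _; apply: vf].
Qed.

Lemma qeval_QAnd v q r : qeval v (QAnd q r) <-> qeval v q /\ qeval v r.
Proof. by split=> /andP. Qed.

Lemma qeval_QImp v q r : qeval v (QImp q r) <-> (qeval v q -> qeval v r).
Proof. by split=> /implyP. Qed.

Lemma qeval_QNeg v q : qeval v (QNeg q) <-> ~ qeval v q.
Proof. by split=> /negP. Qed.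

Lemma valid_constant q (Q : Prop) :
  (forall v, qeval v q <-> Q) -> valid q <-> Q.
Proof. by move=> qQ; split=> [/(_ xpred0)/qQ//|HQ v]; apply/qQ. Qed.

End QbfQuantifiers.

Section AtomQuantifiers.
Variable A : eqType.
Implicit Types (v : qatom A -> bool) (u : A -> bool) (a : form A).
Implicit Types (q : qbf (qatom A)) (xs : seq A).

Definition update_atoms u v (x : qatom A) : bool :=
  if x is Atom p then u p else v x.

Definition atom_in xs (x : qatom A) : bool :=
  if x is Atom p then p \in xs else true.

Lemma qvars_qform a : qvars (qform a) = [seq Atom p | p <- fvars a].
Proof. by elim: a => //= b -> c ->; rewrite map_cat. Qed.

Lemma qeval_qform v a : qeval v (qform a) = feval (v \o @Atom A) a.
Proof. by elim: a => //= [b ->|b -> c ->|b -> c ->|b -> c ->]. Qed.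

Lemma qeval_QExs_Atom v xs q : all (atom_in xs) (qvars q) ->
  qeval v (QExs [seq Atom x | x <- undup xs] q) <->
  exists u, qeval (update_atoms u v) q.
Proof.
move=> q_xs.
have bound p : (Atom p \in [seq Atom x | x <- undup xs]) = (p \in xs).
  by rewrite mem_map ?mem_undup // => x y [].
split=> [/qeval_QExsP[w wv wq]|[u uq]].
  exists (w \o @Atom A); rewrite (eq_in_qeval (w := w) _ q_xs) //.
  by move=> [p|i|i] //= _; rewrite wv // inE; apply/mapP => -[].
apply/qeval_QExsP.
exists (update_atoms (fun p => if p \in xs then u p else v (Atom p)) v).
  by case=> //= p; rewrite !inE bound => /negbTE->.
rewrite (eq_in_qeval (w := update_atoms u v) _ q_xs) // => -[p|i|i] //.
by rewrite unfold_in /= => ->.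
Qed.

Lemma qeval_QAlls_Atom v xs q : all (atom_in xs) (qvars q) ->
  qeval v (QAlls [seq Atom x | x <- undup xs] q) <->
  forall u, qeval (update_atoms u v) q.
Proof.
move=> q_xs; rewrite qeval_QAlls; split=> [/negP vq u|uq].
  by apply: contra_notT vq => uq; apply/qeval_QExs_Atom => //; exists u.
by apply/negP => /qeval_QExs_Atom[//|u /negP]; apply.
Qed.

End AtomQuantifiers.

Lemma set_mem_cons (T : eqType) (x : T) (s : seq T) :
  ([set y | y \in x :: s] = x |` [set y | y \in s])%classic.
Proof. by apply/predeqP => y; rewrite /= inE; split=> /predU1P. Qed.

Section Encodings.
Local Open Scope classical_set_scope.

Variable A : eqType.
Implicit Types (v : qatom A -> bool) (u : A -> bool) (a : form A).
Implicit Types (Vs : seq (form A)) (P : pred (qatom A)).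

Lemma all_qvars_qform P a :
  {in fvars a, forall p, P (Atom p)} -> all P (qvars (qform a)).
Proof. by move=> aP; rewrite qvars_qform all_map; apply/allP. Qed.

Lemma fvars_seq_vars Vs a : a \in Vs -> {subset fvars a <= seq_vars Vs}.
Proof.
by move=> aV x xa; apply/flattenP; exists (fvars a) => //; apply: map_f.
Qed.

Section Guarded.
Variables (I : eqType) (sel : I -> nat) (psi : I -> form A).
Implicit Type s : seq I.

Definition guarded_conj Vs s : qbf (qatom A) :=
  QAnd (QConj [seq qform a | a <- Vs])
       (QConj [seq QImp (QVar (Sel (sel i))) (qform (psi i)) | i <- s]).

Lemma all_qvars_guarded_conj P Vs s :
    (forall i, P (Sel i)) -> {in seq_vars Vs, forall p, P (Atom p)} ->
    {in s, forall i, {in fvars (psi i), forall p, P (Atom p)}} ->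
  all P (qvars (guarded_conj Vs s)).
Proof.
move=> Psel PV Ppsi; rewrite /= all_cat !all_qvars_QConj !all_map.
apply/andP; split; apply/allP.
  by move=> a aV; apply: all_qvars_qform => p /(fvars_seq_vars aV)/PV.
by move=> i si /=; rewrite Psel; apply/all_qvars_qform/Ppsi.
Qed.

Lemma qeval_guarded_conj u v Vs s :
  qeval (update_atoms u v) (guarded_conj Vs s) <->
  [set a | a \in Vs] `|`
    [set psi i | i in [set i | i \in s /\ v (Sel (sel i))]] `<=` holds u.
Proof.
rewrite subUset image_subP /= !qeval_QConj !all_map.
split=> [/andP[/allP uV /allP us]|[uV us]].
  split=> [a /uV|i [si vi]] /=; first by rewrite qeval_qform.
  by have := us i si; rewrite /= vi /= qeval_qform.
apply/andP; split; apply/allP; first by move=> a /uV /=; rewrite qeval_qform.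
by move=> i si /=; rewrite qeval_qform; apply/implyP => vi; apply: us.
Qed.

End Guarded.

Lemma qeval_Compat v Vs (S : seq (nat * form A)) :
  qeval v (Compat Vs S) <->
  satisfiable ([set a | a \in Vs] `|`
               [set s.2 | s in [set s | s \in S /\ v (Sel s.1)]]).
Proof.
rewrite /Compat -/(guarded_conj fst snd Vs S) qeval_QExs_Atom.
  by split=> -[u /qeval_guarded_conj]; exists u => //; apply/qeval_guarded_conj.
apply: all_qvars_guarded_conj => [//|p pV|s sS p ps] /=; rewrite mem_cat ?pV //.
by rewrite (fvars_seq_vars (map_f _ sS) ps) orbT.
Qed.

Section FiniteDefaults.
Variables (n : nat) (delta : 'I_n -> default A) (Vs : seq (form A)).
Implicit Types (g : pred 'I_n) (S : set (default A)).

Local Notation V := [set a | a \in Vs].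
Local Notation D := (range delta).
Local Notation maximal := (maximal_justified V D).

Definition selected g : set (default A) := [set delta i | i in [set i | g i]].

Lemma selected_range g : selected g `<=` D.
Proof. by move=> _ [i _ <-]; exists i. Qed.

Lemma selected_preimage S :
  S `<=` D -> selected (fun i => `[< S (delta i) >]) = S.
Proof.
move=> SD; apply/seteqP; split=> [_ [i /asboolP Si <-] //|d Sd].
by have [i _ di] := SD d Sd; exists i => //=; apply/asboolP; rewrite di.
Qed.

Lemma selected_setU1 i g :
  delta i |` selected g = selected (fun k => (k == i) || g k).
Proof.
apply/seteqP; split=> [d [->|[k gk <-]]|_ [k /orP[/eqP->|gk] <-]].
- by exists i => //=; rewrite eqxx.
- by exists k => //=; rewrite gk orbT.
- by left.
- by right; exists k.
Qed.

Lemma maximal_justified_exists : satisfiable V -> maximal !=set0.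
Proof.
move=> satV.
pose consistent (B : {set 'I_n}) := `[< justified V (selected (mem B)) >].
have consistent0 : consistent finset.set0.
  apply/asboolP; apply: satisfiableS satV.
  by rewrite subUset; split=> // a [d [i]]; rewrite /= inE.
have [B Bmax _] := maxset_exists consistent0.
exists (selected (mem B)); split.
- exact: selected_range.
- exact/asboolP/(maxsetp Bmax).
- move=> _ [i _ <-]; rewrite selected_setU1 => iJ; exists i => //=.
  have /(maxsetsup Bmax) <- : consistent (i |: B)%SET.
  + apply/asboolP; apply: subset_justified iJ.
    by move=> _ [k /= /[!inE] ? <-]; exists k.
  + by rewrite !inE eqxx.
  + exact: finset.subsetUr.
Qed.

Lemma qeval_Compat_just v Vs' (ks : seq 'I_n) :
  qeval v (Compat Vs' [seq (nat_of_ord k, just (delta k)) | k <- ks]) <->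
  justified [set a | a \in Vs'] (selected (fun k => (k \in ks) && v (Sel k))).
Proof.
rewrite qeval_Compat /justified /selected image_comp.
set selS := [set s.2 | s in _]; suff -> : selS =
  [set (@just A \o delta) k | k in [set k | (k \in ks) && v (Sel k)]] by [].
apply/seteqP; split=> [_ [_ [/mapP[k ksk ->] vk] <-]|_ [k /andP[ksk vk] <-]].
  by exists k => //=; rewrite ksk.
by exists (nat_of_ord k, just (delta k)) => //; split=> //; apply: map_f.
Qed.

Lemma qeval_Conseq v chi :
  qeval v (Conseq delta Vs chi) <->
  generated V (selected (fun i => v (Sel i))) chi.
Proof.
rewrite /Conseq -/(guarded_conj _ (@concl A \o delta) Vs (enum 'I_n)).
rewrite qeval_QAlls_Atom; last first.
  rewrite /= all_cat all_qvars_guarded_conj /= => [|//|p pV|i _ p pi].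
  - by apply: all_qvars_qform => p pchi; rewrite /= !mem_cat pchi !orbT.
  - by rewrite mem_cat pV.
  - rewrite !mem_cat; apply/or3P/Or32/flattenP; exists (dvars (delta i)).
      by apply/mapP; exists i; rewrite ?mem_enum.
    by rewrite !mem_cat pi !orbT.
have conclsE :
    [set (@concl A \o delta) i | i in [set i | i \in enum 'I_n /\ v (Sel i)]] =
    [set concl d | d in selected (fun i => v (Sel i))].
  rewrite image_comp; congr image; apply/seteqP; split=> i; first by case.
  by split; rewrite ?mem_enum.
rewrite /generated -conclsE; split=> vchi u.
  move/qeval_guarded_conj; move/qeval_QImp: (vchi u) => /[apply].
  by rewrite qeval_qform.
by apply/qeval_QImp => /qeval_guarded_conj/vchi; rewrite qeval_qform.
Qed.

Lemma qeval_Conseq' v chi :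
  qeval v (Conseq' delta Vs chi) <->
  generated V (selected (fun i => v (Sel' i))) chi.
Proof.
pose unprimed (x : qatom A) := if x is Sel' _ then false else true.
rewrite /Conseq' (qeval_qrename (P := unprimed) (v := v \o @prime_sel A)) //.
- exact: qeval_Conseq.
- by case=> [p|i|i] [q|j|j] // _ _ [->].
rewrite /Conseq -/(guarded_conj _ (@concl A \o delta) Vs (enum 'I_n)).
rewrite all_qvars_QAlls all_map; apply/andP; split; first exact/allP.
by rewrite /= all_cat all_qvars_guarded_conj //; apply: all_qvars_qform.
Qed.

Lemma qeval_QExs_sel (sel : nat -> qatom A) v q (P : set (default A) -> Prop) :
    injective sel ->
    (forall w, qeval w q <-> P (selected (fun i => w (sel i)))) ->
  qeval v (QExs [seq sel i | i <- iota 0 n] q) <-> exists2 S, S `<=` D & P S.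
Proof.
move=> sel_inj qP; split=> [/qeval_QExsP[w _ /qP Pw]|[S SD PS]].
  by exists (selected (fun i => w (sel i))) => //; apply: selected_range.
pose w x :=
  if [pick i : 'I_n | sel i == x] is Some i then `[< S (delta i) >] else v x.
apply/qeval_QExsP; exists w => [x|].
  rewrite inE /w => xG; case: pickP => // i /eqP ix.
  by case/mapP: xG; exists (nat_of_ord i); rewrite ?mem_iota ?ltn_ord.
apply/qP; rewrite -(selected_preimage SD) in PS; congr P: PS; congr selected.
apply: funext => i; rewrite /w; case: pickP => [j /eqP/sel_inj/val_inj->//|].
by move/(_ i); rewrite eqxx.
Qed.

Lemma qeval_QExsG v q (P : set (default A) -> Prop) :
    (forall w, qeval w q <-> P (selected (fun i => w (Sel i)))) ->
  qeval v (QExs (G n) q) <-> exists2 S, S `<=` D & P S.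
Proof. by apply: qeval_QExs_sel => i j []. Qed.

Lemma qeval_QExsG' v q (P : set (default A) -> Prop) :
    (forall w, qeval w q <-> P (selected (fun i => w (Sel' i)))) ->
  qeval v (QExs (G' n) q) <-> exists2 S, S `<=` D & P S.
Proof. by apply: qeval_QExs_sel => i j []. Qed.

Hypothesis delta_inj : injective delta.

Lemma selectedE g i : selected g (delta i) <-> g i.
Proof. by split=> [[j gj /delta_inj <-]|gi] //; exists i. Qed.

Lemma qeval_Compat_other v (i : 'I_n) : ~~ v (Sel i) ->
  qeval v (Compat (just (delta i) :: Vs)
    [seq (nat_of_ord k, just (delta k)) | k <- enum 'I_n & k != i]) <->
  justified V (delta i |` selected (fun k => v (Sel k))).
Proof.
move=> vi; rewrite qeval_Compat_just justified_setU1 /justified setUA.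
rewrite -set_mem_cons; set others := selected _.
suff -> : others = selected (fun k => v (Sel k)) by [].
congr selected; apply: funext => k; rewrite mem_filter mem_enum andbT.
by case: eqVneq => // ->; rewrite (negbTE vi).
Qed.

Lemma qeval_Ext v :
  qeval v (Ext delta Vs) <-> maximal (selected (fun i => v (Sel i))).
Proof.
have allE : selected (fun k => (k \in enum 'I_n) && v (Sel k)) =
    selected (fun k => v (Sel k)).
  by congr selected; apply: funext => k; rewrite mem_enum.
rewrite /Ext qeval_QAnd qeval_Compat_just allE qeval_QConj_enum.
split=> [[vJ vmax]|[_ vJ vmax]]; split=> //; first exact: selected_range.
  move=> _ [i _ <-] iJ; apply/selectedE; apply: contraT => vi.
  by have /qeval_QImp/(_ vi)/qeval_QNeg[] := vmax i; apply/qeval_Compat_other.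
move=> i; apply/qeval_QImp => vi; apply/qeval_QNeg => /(qeval_Compat_other vi).
by move/(vmax _ (imageT delta i))/selectedE; apply/negP.
Qed.

Lemma qeval_QExsG_Ext v q (P : set (default A) -> Prop) :
    (forall w, qeval w q <-> P (selected (fun i => w (Sel i)))) ->
  qeval v (QExs (G n) (QAnd (Ext delta Vs) q)) <-> exists2 S, maximal S & P S.
Proof.
move=> qP; rewrite (qeval_QExsG v (P := fun S => maximal S /\ P S)).
  by split=> [[S _ []]|[S Smax PS]]; exists S => //; case: Smax.
by move=> w; rewrite qeval_QAnd qeval_Ext qP.
Qed.

Lemma qeval_QExsG_Ext_QNeg_Conseq v chi :
  qeval v (QExs (G n) (QAnd (Ext delta Vs) (QNeg (Conseq delta Vs chi)))) <->
  exists2 S, maximal S & ~ generated V S chi.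
Proof.
apply: (qeval_QExsG_Ext v (P := fun S => ~ generated V S chi)) => w.
by rewrite qeval_QNeg qeval_Conseq.
Qed.

Lemma qeval_Psi v : qeval v (Psi delta Vs) <->
  skeptical_defaults V D `<=` selected (fun i => v (Sel' i)).
Proof.
rewrite /Psi qeval_QConj_enum; split=> [vP d [[i _ <-] iS]|vP i].
  apply/selectedE; apply: contraT => vi.
  by have /qeval_QImp/(_ vi)/qeval_QExsG_Ext_QNeg_Conseq[S /iS Si []] := vP i.
apply/qeval_QImp => /negP vi; apply/qeval_QExsG_Ext_QNeg_Conseq.
apply: contrapT => noS.
apply: vi; apply/(selectedE (fun k => v (Sel' k)) i)/vP; split=> [|S Smax].
  by exists i.
by apply: contrapT => SN; apply: noS; exists S.
Qed.

Lemma valid_QExs_Conseq chi :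
  valid (QExs (G n) (QAnd (Ext delta Vs) (Conseq delta Vs chi))) <->
  (\bigcup_(S in maximal) generated V S) chi.
Proof.
apply: valid_constant => v.
apply: (qeval_QExsG_Ext v (P := fun S => generated V S chi)) => w.
exact: qeval_Conseq.
Qed.

Lemma valid_QNeg_QExs_Conseq chi :
  valid (QNeg (QExs (G n)
    (QAnd (Ext delta Vs) (QNeg (Conseq delta Vs chi))))) <->
  (\bigcap_(S in maximal) generated V S) chi.
Proof.
apply: valid_constant => v; rewrite qeval_QNeg qeval_QExsG_Ext_QNeg_Conseq.
split=> [noS S Smax|all_chi [S /all_chi]] //.
by apply: contrapT => SN; apply: noS; exists S.
Qed.

Lemma valid_QNeg_QExs_Psi chi :
  valid (QNeg (QExs (G' n)
    (QAnd (QNeg (Conseq' delta Vs chi)) (Psi delta Vs)))) <->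
  generated V (skeptical_defaults V D) chi.
Proof.
apply: valid_constant => v; rewrite qeval_QNeg (qeval_QExsG' v (P := fun S =>
  ~ generated V S chi /\ skeptical_defaults V D `<=` S)); last first.
  by move=> w; rewrite qeval_QAnd qeval_QNeg qeval_Conseq' qeval_Psi.
split=> [noS|chi_sk [S _ [SN skS]]]; last first.
  exact/SN/(subset_generated skS).
apply: contrapT => skN; apply: noS.
by exists (skeptical_defaults V D); [move=> d [] | split].
Qed.

End FiniteDefaults.

End Encodings.

Section UnsignedConsequence.
Local Open Scope classical_set_scope.

Variables (Sigma : eqType) (T0 : theory (satom Sigma)) (phi : form Sigma).

Local Notation V := (fact_set T0).
Local Notation maximal := (maximal_justified V (defaults T0)).

Hypothesis governed : justification_governed V (defaults T0).

Lemma credulousE :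
  credulous T0 phi <-> (\bigcup_(S in maximal) generated V S) (embed phi).
Proof. by rewrite -(image_generating_extensions governed) bigcup_image. Qed.

Lemma skepticalE :
  skeptical T0 phi <-> (\bigcap_(S in maximal) generated V S) (embed phi).
Proof. by rewrite -(image_generating_extensions governed) bigcap_image. Qed.

Lemma prudentE :
  prudent T0 phi <->
  Cn (V `|` \bigcap_(S in maximal) [set concl d | d in S]) (embed phi).
Proof. by rewrite -(image_generating_extensions governed) bigcap_image. Qed.

End UnsignedConsequence.

(** * Signed theories *)

Section Replacement.
Variables (A : eqType) (B : Type) (f : position -> bool -> A -> form B).

Lemma all_fvars_replace_occs (P : pred B) (a : form A) :
    (forall pi s p, p \in fvars a -> all P (fvars (f pi s p))) ->
  all P (fvars (replace_occs f a)).
Proof.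
rewrite /replace_occs; move: [::] true.
elim: a => /= [p|b IHb|b IHb c IHc|b IHb c IHc|b IHb c IHc] pi s fP.
- by apply: fP; rewrite mem_head.
- exact: IHb.
all: rewrite all_cat IHb ?IHc // => ? ? ? pa;
  by apply: fP; rewrite mem_cat pa ?orbT.
Qed.

Lemma feval_replace_occs_polarity (v : B -> bool) (a : form A) :
  (forall pi s p, feval v (f pi s p) = s) -> feval v (replace_occs f a).
Proof.
move=> fs; suff : forall pi s, feval v (replace_rec f pi s a) = s by move->.
elim: a => /= [p|b IHb|b IHb c IHc|b IHb c IHc|b IHb c IHc] pi s //.
- by rewrite IHb negbK.
all: by rewrite IHb IHc; case: s.
Qed.

End Replacement.

Lemma occs_fvars (A : eqType) (a : form A) o : o \in occs a -> o.2 \in fvars a.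
Proof.
rewrite /occs; move: [::] true.
elim: a => /= [p|b IHb|b IHb c IHc|b IHb c IHc|b IHb c IHc] pi s.
- by move=> /[!inE] /eqP->.
- exact: IHb.
all: by rewrite !mem_cat => /orP[/IHb->|/IHc->]; rewrite ?orbT.
Qed.

Lemma complementary_seq_vars (Sigma : eqType) (W : seq (form Sigma)) :
  {subset complementary W <= seq_vars W}.
Proof.
move=> p /andP[/hasP[a aW /hasP[o oa /andP[_ /eqP <-]]] _].
by apply: (fvars_seq_vars aW); apply: occs_fvars.
Qed.

Section SignedTheories.
Local Open Scope classical_set_scope.

Variables (Sigma : eqType) (W : seq (form Sigma)).
Implicit Types (x : satom Sigma) (v : satom Sigma -> bool) (p : Sigma).
Implicit Types (d : default (satom Sigma)) (a b : form (satom Sigma)).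

Definition base x : Sigma := (satom_encode x).1.

Definition is_signed x : bool := if x is Orig _ then false else true.

Definition fact_atom x : bool := is_signed x && (base x \in seq_vars W).

Definition signed_literals
    (f : position -> bool -> Sigma -> form (satom Sigma)) : Prop :=
  forall pi s p, exists x, [/\ is_signed x, base x = p
    & f pi s p = if s then Var x else Neg (Var x)].

Variant unsigning_default (indexed : pred Sigma) p :
    default (satom Sigma) -> Prop :=
| UnsigningDelta of ~~ indexed p : unsigning_default indexed p (delta_ p)
| UnsigningNormal b of indexed p & {in fvars b, forall x, base x = p} :
    unsigning_default indexed p (normal_default p b).

(* [indexed] is empty for [D_Sigma], and [complementary W] for [D1_Sigma] and
   [D2_Sigma]. *)
Record unsigning_theory (indexed : pred Sigma) (T0 : theory (satom Sigma)) :
    Prop := {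
  unsigning_fact_atoms : {in facts T0, forall a, all fact_atom (fvars a)};
  unsigning_satisfiable : satisfiable (fact_set T0);
  unsigning_defaults :
    forall d, defaults T0 d -> exists p, unsigning_default indexed p d;
  unsigning_indexed : {subset indexed <= seq_vars W} }.

Lemma all_fact_atom_replace_occs f (c : form Sigma) :
    signed_literals f -> c \in W ->
  all fact_atom (fvars (replace_occs f c)).
Proof.
move=> flit cW; apply: all_fvars_replace_occs => pi s p pc.
have [x [x_signed xp ->]] := flit pi s p.
by case: s; rewrite /= /fact_atom x_signed xp (fvars_seq_vars cW pc).
Qed.

Lemma satisfiable_replace_occs (f : form Sigma -> _) :
    (forall c, signed_literals (f c)) ->
  satisfiable [set a | a \in [seq replace_occs (f c) c | c <- W]].
Proof.
move=> flit; exists xpredT => _ /mapP[c _ ->].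
apply: feval_replace_occs_polarity => pi s p.
by have [x [_ _ ->]] := flit c pi s p; case: s.
Qed.

Lemma signed_literals_signed_lit :
  signed_literals (fun=> @signed_lit Sigma).
Proof. by move=> _ s p; case: s; [exists (Plus p) | exists (Minus p)]. Qed.

Lemma signed_literals_indexed (I : form Sigma * position -> nat) c :
  signed_literals (fun pi s p => if complementary W p then
    if s then Var (PlusI p (I (c, pi))) else Neg (Var (MinusI p (I (c, pi))))
    else signed_lit s p).
Proof.
move=> pi s p; case: ifP => _; last exact: signed_literals_signed_lit.
by case: s; [exists (PlusI p (I (c, pi))) | exists (MinusI p (I (c, pi)))].
Qed.

Lemma unsigning_theory_signed_setI I D :
    (forall d, D d -> exists p, unsigning_default (complementary W) p d) ->
  unsigning_theory (complementary W) (Theory D (signed_setI W I)).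
Proof.
move=> unsignD; split=> [_ /mapP[c cW ->]||//|].
- exact: (all_fact_atom_replace_occs (signed_literals_indexed I c) cW).
- exact: (satisfiable_replace_occs (signed_literals_indexed I)).
- exact: complementary_seq_vars.
Qed.

Lemma signed_theories_unsigning T0 :
  signed_theories W T0 -> exists indexed, unsigning_theory indexed T0.
Proof.
have normal p b : complementary W p -> all (fun y => base y == p) (fvars b) ->
    exists q, unsigning_default (complementary W) q (normal_default p b).
  by move=> pW /allP bp; exists p; apply: UnsigningNormal => // x /bp/eqP.
have delta p : complementary W p = false ->
    exists q, unsigning_default (complementary W) q (delta_ p).
  by move=> pW; exists p; apply: UnsigningDelta; rewrite pW.
have lit := signed_literals_signed_lit.
case=> [|I _|I _].
- exists xpred0; split=> //= [_ /mapP[c cW ->]||_ [p _ <-]].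
  + exact: (all_fact_atom_replace_occs lit cW).
  + exact: (satisfiable_replace_occs (fun=> lit)).
  + by exists p; apply: UnsigningDelta.
- exists (complementary W); apply: unsigning_theory_signed_setI => d [p].
  case: ifP => [pW|pW ->]; last exact: delta.
  by move=> [i [j [_ _ ->]]]; apply: normal => //=; rewrite /base /= !eqxx.
- exists (complementary W); apply: unsigning_theory_signed_setI => d [p].
  case: ifP => [pW|pW ->]; last exact: delta.
  by case=> -[i _ ->]; apply: normal => //=; rewrite /base /= !eqxx.
Qed.

Definition unsign (indexed : pred Sigma) v x : bool :=
  if x is Orig p then if indexed p then v x else v (Plus p) else v x.

Definition sign_outside v x : bool :=
  match x with
  | Plus p => if p \in seq_vars W then v x else v (Orig p)
  | Minus p => if p \in seq_vars W then v x else ~~ v (Orig p)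
  | _ => v x
  end.

Lemma feval_sign_outside v a :
    {in fvars a, forall x, is_signed x -> base x \in seq_vars W} ->
  feval (sign_outside v) a = feval v a.
Proof. by move=> aW; apply: eq_in_feval => -[] p //= => [/aW|/aW] /= ->. Qed.

Lemma feval_sign_outside_embed v (phi : form Sigma) :
  feval (sign_outside v) (embed phi) = feval v (embed phi).
Proof. by elim: phi => //= [b ->|b -> c ->|b -> c ->|b -> c ->]. Qed.

Lemma unsigning_default_vars indexed p d : unsigning_default indexed p d ->
  {in dvars d, forall x, base x = p} /\ Orig p \in dvars d.
Proof.
case=> [_|b _ bp]; split; try exact: mem_head.
  suff /allP dp : all (fun x => base x == p) (dvars (delta_ p)).
    by move=> x /dp/eqP.
  by rewrite /= /base /= !eqxx.
by move=> x; rewrite !(inE, mem_cat) => /or4P[/eqP->|/eqP->|/bp|/bp].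
Qed.

Section UnsigningTheory.
Variables (indexed : pred Sigma) (T0 : theory (satom Sigma)).
Hypothesis T0_unsigning : unsigning_theory indexed T0.

Lemma holds_unsigning_facts v w :
    (forall x, fact_atom x -> v x = w x) ->
  fact_set T0 `<=` holds v -> fact_set T0 `<=` holds w.
Proof.
move=> vw Vv a aT; rewrite /holds /= -(@eq_in_feval _ v w); first exact: Vv.
by move=> x; move/allP: (unsigning_fact_atoms T0_unsigning aT) => /[apply]/vw.
Qed.

Lemma unsigning_justification_governed :
  justification_governed (fact_set T0) (defaults T0).
Proof.
split=> [d v dT|d v dT|v Vv|]; last exact: unsigning_satisfiable T0_unsigning.
- by have [p [_|b _ _]] := unsigning_defaults T0_unsigning dT; apply: implybb.
- have [p [_|b _ _]] := unsigning_defaults T0_unsigning dT; rewrite //=.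
  by case: (v (Orig p)) (v (Plus p)) (v (Minus p)) => [] [] [].
- exists (unsign indexed v); first by apply: holds_unsigning_facts Vv; case.
  move=> d dT; have [p [pN|b ip bp]] := unsigning_defaults T0_unsigning dT.
    by rewrite /= (negbTE pN); case: (v (Plus p)) (v (Minus p)) => [] [].
  rewrite /= (@eq_in_feval _ (unsign indexed v) v) //.
  by move=> [q|q|q|q i|q i] //= /bp; rewrite /base /= => ->; rewrite ip.
Qed.

Lemma restriction_vars d :
  defaults (restriction W T0) d ->
  {in dvars d, forall x, base x \in seq_vars W}.
Proof.
move=> [dT [q [a [aW qa qd]]]] x xd.
have [p /unsigning_default_vars[dp _]] := unsigning_defaults T0_unsigning dT.
by rewrite dp // -(dp _ qd) (fvars_seq_vars aW qa).
Qed.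

Lemma restriction_completion :
  completion (fact_set T0) (defaults (restriction W T0)) (defaults T0)
    sign_outside.
Proof.
split=> [v|v d dR|v d dR|v d [dT dN]].
- by apply: holds_unsigning_facts => -[] //= p /andP[_] /= ->.
- apply: feval_sign_outside => x xd _.
  by apply: (restriction_vars dR); rewrite !mem_cat xd orbT.
- apply: feval_sign_outside => x xd _.
  by apply: (restriction_vars dR); rewrite !mem_cat xd !orbT.
have [p dp] := unsigning_defaults T0_unsigning dT.
have [/flatten_mapP[a aW pa]|pW] := boolP (p \in seq_vars W).
  by case: dN; split=> //; exists p, a; case: (unsigning_default_vars dp).
case: dp => [_|b /(unsigning_indexed T0_unsigning)].
  by rewrite /= (negbTE pW); case: (v (Orig p)).
by rewrite (negbTE pW).
Qed.

Variable phi : form Sigma.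

Local Notation V := (fact_set T0).
Local Notation D := (defaults (restriction W T0)).

Let sub_restriction : D `<=` defaults T0. Proof. by move=> d []. Qed.

Let phi_id v := feval_sign_outside_embed v phi.

Lemma credulous_restriction :
  credulous T0 phi <->
  (\bigcup_(S in maximal_justified V D) generated V S) (embed phi).
Proof.
have governed := unsigning_justification_governed; rewrite credulousE //.
exact: (bigcup_generated_completion sub_restriction governed
  restriction_completion phi_id).
Qed.

Lemma skeptical_restriction :
  skeptical T0 phi <->
  (\bigcap_(S in maximal_justified V D) generated V S) (embed phi).
Proof.
have governed := unsigning_justification_governed; rewrite skepticalE //.
exact: (bigcap_generated_completion sub_restriction governed
  restriction_completion phi_id).
Qed.

Lemma prudent_restriction : maximal_justified V D !=set0 ->
  prudent T0 phi <-> generated V (skeptical_defaults V D) (embed phi).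
Proof.
have governed := unsigning_justification_governed => max_ex.
rewrite prudentE // /generated -bigcap_maximal_concl //; last first.
  exact: subset_governed governed.
exact: (Cn_bigcap_completion sub_restriction governed
  restriction_completion phi_id max_ex).
Qed.

End UnsigningTheory.

End SignedTheories.

Theorem theorem7 (Sigma : eqType) (W : seq (form Sigma))
    (T0 T : theory (satom Sigma))
    (T0_in : signed_theories W T0) (T_restr : T = restriction W T0)
    (n : nat) (delta : 'I_n -> default (satom Sigma))
    (delta_inj : injective delta)
    (delta_enum : forall d, defaults T d <-> exists i, delta i = d)
    (phi : form Sigma) :
  [/\ credulous T0 phi <->
        valid (QExs (G n) (QAnd (Ext delta (facts T))
                                (Conseq delta (facts T) (embed phi)))),
      skeptical T0 phi <->
        valid (QNeg (QExs (G n) (QAnd (Ext delta (facts T))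
                                      (QNeg (Conseq delta (facts T) (embed phi))))))
    & prudent T0 phi <->
        valid (QNeg (QExs (G' n) (QAnd (QNeg (Conseq' delta (facts T) (embed phi)))
                                       (Psi delta (facts T)))))].
Proof.
have [indexed T0_unsigning] := signed_theories_unsigning T0_in.
have restrictionE : defaults (restriction W T0) = range delta.
  apply/predeqP => d; rewrite -T_restr delta_enum.
  by split=> [[i]|[i _]]; exists i.
have satisfiable_facts := unsigning_satisfiable T0_unsigning.
have max_ex := maximal_justified_exists delta satisfiable_facts.
rewrite -restrictionE in max_ex; rewrite {}T_restr; split.
- rewrite (credulous_restriction T0_unsigning) restrictionE.
  by rewrite valid_QExs_Conseq.
- rewrite (skeptical_restriction T0_unsigning) restrictionE.
  by rewrite valid_QNeg_QExs_Conseq.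
- rewrite (prudent_restriction T0_unsigning _ max_ex) restrictionE.
  by rewrite valid_QNeg_QExs_Psi.
Qed.
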